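(* Let $f$ be differentiable, not necessarily convex, on $\mathcal{X}=\mathcal{X}_1\times\cdots\times\mathcal{X}_{N_b}$, let $\alpha=B/N_b$, and let $\{\gamma_t\}_{t=0,1,\ldots}$ be a predefined (deterministic) step-size sequence with $0\le\gamma_t\le 1$ for all $t$. Then the iterates $\{\mathbf{x}^t\}$ of the randomized block Frank-Wolfe algorithm with step sizes $\{\gamma_t\}$ satisfy, for every $t\ge 0$ with $\sum_{k=0}^t\gamma_k>0$, $$g_t\le \frac{h(\mathbf{x}^0)}{\alpha\sum_{k=0}^t\gamma_k}+\frac{\bar C_f^{B}\sum_{k=0}^t\gamma_k^2}{2\alpha\sum_{k=0}^t\gamma_k},$$ where $g_t:=\min_{k\in\{0,1,\ldots,t\}}\mathbb{E}[g(\mathbf{x}^k)]$.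
   Context: Setting. $N_b\ge 1$ is an integer, $\mathcal{N}_b=\{1,\ldots,N_b\}$, $B\in\{1,\ldots,N_b\}$, $\alpha:=B/N_b$. Vectors $\mathbf{x}\in\mathbb{R}^d$ are split into blocks $\mathbf{x}=(\mathbf{x}_1,\ldots,\mathbf{x}_{N_b})$. The feasible set is $\mathcal{X}=\mathcal{X}_1\times\cdots\times\mathcal{X}_{N_b}$, with each $\mathcal{X}_n$ nonempty, convex and compact. The objective $f$ is real-valued and differentiable on (an open set containing) $\mathcal{X}$; $\nabla_{\mathbf{x}_n}f$ denotes the partial gradient with respect to block $n$. The problem is to minimize $f$ over $\mathcal{X}$; $\mathbf{x}^*$ is a global minimizer of $f$ over $\mathcal{X}$, and $h(\mathbf{x}):=f(\mathbf{x})-f(\mathbf{x}^* )$. The duality gap (a measure of non-stationarity) is $g(\mathbf{x}):=\sup_{\mathbf{s}\in\mathcal{X}}(\mathbf{x}-\mathbf{s})^\top\nabla f(\mathbf{x})$ for $\mathbf{x}\in\mathcal{X}$. Randomized block Frank-Wolfe algorithm. Start from a (deterministic) $\mathbf{x}^0\in\mathcal{X}$. At iteration $t=0,1,\ldots$: draw $\mathcal{B}_t$ uniformly at random among all subsets of $\mathcal{N}_b$ with exactly $B$ elements, independently of previous draws; for each $n\in\mathcal{B}_t$ pick a minimizer $\mathbf{s}_n^t\in\arg\min_{\mathbf{s}_n\in\mathcal{X}_n}\langle \mathbf{s}_n,\nabla_{\mathbf{x}_n}f(\mathbf{x}^t)\rangle$ (ties broken arbitrarily, as a function of the draws $\mathcal{B}_0,\ldots,\mathcal{B}_t$);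 set $\mathbf{x}_n^{t+1}=(1-\gamma_t)\mathbf{x}_n^t+\gamma_t\mathbf{s}_n^t$ for $n\in\mathcal{B}_t$ and $\mathbf{x}_n^{t+1}=\mathbf{x}_n^t$ for $n\notin\mathcal{B}_t$. Expectations are over the random draws. Curvature. For $\mathcal{B}\subseteq\mathcal{N}_b$, $$C_f^{\mathcal{B}}:=\sup \frac{2}{\gamma^2}\Big(f(\mathbf{y})-f(\mathbf{x})-\sum_{n\in\mathcal{B}}\langle\mathbf{y}_n-\mathbf{x}_n,\nabla_{\mathbf{x}_n}f(\mathbf{x})\rangle\Big),$$ the supremum being over $\gamma\in(0,1]$, $\mathbf{x}\in\mathcal{X}$, $\mathbf{s}_n\in\mathcal{X}_n$ ($n\in\mathcal{B}$), where $\mathbf{y}_n=(1-\gamma)\mathbf{x}_n+\gamma\mathbf{s}_n$ for $n\in\mathcal{B}$ and $\mathbf{y}_n=\mathbf{x}_n$ otherwise. The expected set curvature is $\bar C_f^{B}:=\binom{N_b}{B}^{-1}\sum_{\mathcal{B}\subseteq\mathcal{N}_b,\,|\mathcal{B}|=B}C_f^{\mathcal{B}}$. It is assumed throughout that $C_f:=C_f^{\mathcal{N}_b}$ is finite (hence so are all $C_f^{\mathcal{B}}$ and $\bar C_f^{B}$). *)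

(* Defs.v *)
From HB Require Import structures.
From mathcomp Require Import all_boot all_order all_algebra.
From mathcomp Require Import all_classical all_reals all_analysis.

Set Implicit Arguments.
Unset Strict Implicit.
Unset Printing Implicit Defensive.

Import Order.TTheory GRing.Theory Num.Theory.
Import numFieldNormedType.Exports.

Local Open Scope classical_set_scope.
Local Open Scope ring_scope.

Definition dotv (R : realType) (m : nat) (u v : 'rV[R]_m) : R :=
  (u *m v^T) 0 0.

(* The n-th block of x : 'rV[R]_(\sum_n dim n) is submxrow x n. *)
Definition block_product (R : realType) (Nb : nat) (dim : 'I_Nb -> nat)
    (X : forall n : 'I_Nb, set 'rV[R]_(dim n)) :
    set 'rV[R]_(\sum_(n < Nb) dim n) :=
  [set x | forall n, X n (submxrow x n)].

Definition gradient (R : realType) (m : nat) (f : 'rV[R]_m -> R)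
    (x : 'rV[R]_m) : 'rV[R]_m :=
  \row_(j < m) 'D_(delta_mx 0 j) f x.

Definition block_gradient (R : realType) (Nb : nat) (dim : 'I_Nb -> nat)
    (f : 'rV[R]_(\sum_(n < Nb) dim n) -> R) (x : 'rV[R]_(\sum_(n < Nb) dim n))
    (n : 'I_Nb) : 'rV[R]_(dim n) :=
  submxrow (gradient f x) n.

(* For X compact and nonempty the set is bounded and nonempty, so that the
   real-valued sup is the actual supremum. *)
Definition duality_gap (R : realType) (m : nat) (X : set 'rV[R]_m)
    (f : 'rV[R]_m -> R) (x : 'rV[R]_m) : R :=
  sup [set dotv (x - s) (gradient f x) | s in X].

(* Only the values s n with n \in S are used. *)
Definition block_step (R : realType) (Nb : nat) (dim : 'I_Nb -> nat)
    (gamma : R) (S : {set 'I_Nb}) (x : 'rV[R]_(\sum_(n < Nb) dim n))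
    (s : forall n : 'I_Nb, 'rV[R]_(dim n)) : 'rV[R]_(\sum_(n < Nb) dim n) :=
  \mxrow_(n < Nb) (if n \in S
                   then (1 - gamma) *: submxrow x n + gamma *: s n
                   else submxrow x n).

Definition set_curvature (R : realType) (Nb : nat) (dim : 'I_Nb -> nat)
    (X : forall n : 'I_Nb, set 'rV[R]_(dim n))
    (f : 'rV[R]_(\sum_(n < Nb) dim n) -> R) (S : {set 'I_Nb}) : \bar R :=
  ereal_sup [set c | exists (gamma : R) x s,
    [/\ 0 < gamma <= 1,
        block_product X x,
        forall n, n \in S -> X n (s n) &
        let y := block_step gamma S x s in
        c = (2 / gamma ^+ 2 *
             (f y - f x - \sum_(n in S)
                dotv (submxrow y n - submxrow x n) (block_gradient f x n)))%:E]].

Definition expected_set_curvature (R : realType) (Nb : nat)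
    (dim : 'I_Nb -> nat) (X : forall n : 'I_Nb, set 'rV[R]_(dim n))
    (f : 'rV[R]_(\sum_(n < Nb) dim n) -> R) (B : nat) : \bar R :=
  (('C(Nb, B)%:R^-1)%:E *
   \sum_(S : {set 'I_Nb} | #|S| == B) set_curvature X f S)%E.

(* {set 'I_Nb} carries the discrete sigma-algebra; independence is mutual
   independence of the whole family (draw t)_t. *)
Record iid_uniform_draws (R : realType) (disp : measure_display)
    (Omega : measurableType disp) (P : probability Omega R) (Nb B : nat)
    (draw : nat -> Omega -> {set 'I_Nb}) : Prop := IIDUniformDraws {
  draw_measurable : forall t (E : set {set 'I_Nb}),
    measurable (draw t @^-1` E) ;
  draw_uniform : forall t (S : {set 'I_Nb}),
    P (draw t @^-1` [set S]) =
      (if #|S| == B then 'C(Nb, B)%:R^-1 else 0)%:E ;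
  draw_independent : forall (J : seq nat) (E : nat -> set {set 'I_Nb}),
    uniq J ->
    P (\bigcap_(t in [set` J]) (draw t @^-1` E t)) =
      (\prod_(t <- J) P (draw t @^-1` E t))%E }.

Definition is_argmin_linear (R : realType) (m : nat) (X : set 'rV[R]_m)
    (c s : 'rV[R]_m) : Prop :=
  X s /\ forall v, X v -> dotv s c <= dotv v c.

(* s t w n is the minimizer picked for block n at iteration t; it matters only
   for n \in draw t w. By fw_tie_breaking it is a function of
   draw 0 w, ..., draw t w. *)
Record block_frank_wolfe (R : realType) (Nb : nat) (dim : 'I_Nb -> nat)
    (X : forall n : 'I_Nb, set 'rV[R]_(dim n))
    (f : 'rV[R]_(\sum_(n < Nb) dim n) -> R) (gamma : nat -> R)
    (Omega : Type) (draw : nat -> Omega -> {set 'I_Nb})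
    (x0 : 'rV[R]_(\sum_(n < Nb) dim n))
    (s : nat -> Omega -> forall n : 'I_Nb, 'rV[R]_(dim n))
    (x : nat -> Omega -> 'rV[R]_(\sum_(n < Nb) dim n)) : Prop :=
  BlockFrankWolfe {
  fw_init_feasible : block_product X x0 ;
  fw_init : forall w, x 0%N w = x0 ;
  fw_oracle : forall t w n, n \in draw t w ->
    is_argmin_linear (X n) (block_gradient f (x t w) n) (s t w n) ;
  fw_tie_breaking : forall t w w',
    (forall k, (k <= t)%N -> draw k w = draw k w') ->
    forall n, n \in draw t w -> s t w n = s t w' n ;
  fw_step : forall t w,
    x t.+1 w = block_step (gamma t) (draw t w) (x t w) (s t w) }.

(* Main.v *)
(* One block step obeys
     f x' <= f x - gamma * \sum_(n in S) g_n x + gamma ^ 2 / 2 * C_f^S,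
   where g_n, the part of the duality gap carried by block n, satisfies
   \sum_n g_n = g. The iterate x^k is a function of the first k draws, hence
   independent of the k-th draw S, which contains each block with probability
   alpha = B / Nb; taking expectations,
     E f(x^{k+1}) <= E f(x^k) - gamma_k alpha E g(x^k) + gamma_k^2 / 2 * C.
   Telescope and bound every E g(x^k) from below by the minimum. *)

Require Import Defs.
From HB Require Import structures.
From mathcomp Require Import all_boot all_order all_algebra.
From mathcomp Require Import all_classical all_reals all_analysis.
From mathcomp Require Import ring lra.

Set Implicit Arguments.
Unset Strict Implicit.
Unset Printing Implicit Defensive.

Import Order.TTheory GRing.Theory Num.Theory.
Import numFieldNormedType.Exports.

Local Open Scope classical_set_scope.
Local Open Scope ring_scope.

(** * Linear minimization and the duality gap over blocks *)

Lemma dotvBl (R : realType) (m : nat) (u v w : 'rV[R]_m) :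
  dotv (u - v) w = dotv u w - dotv v w.
Proof. by rewrite /dotv mulmxBl [LHS]mxE [X in _ + X]mxE. Qed.

Lemma dotvZl (R : realType) (m : nat) (a : R) (u w : 'rV[R]_m) :
  dotv (a *: u) w = a * dotv u w.
Proof. by rewrite /dotv -scalemxAl [LHS]mxE. Qed.

Lemma dotv_submxrow (R : realType) (Nb : nat) (dim : 'I_Nb -> nat)
    (u v : 'rV[R]_(\sum_(n < Nb) dim n)) :
  dotv u v = \sum_n dotv (submxrow u n) (submxrow v n).
Proof.
rewrite /dotv -[in LHS](submxrowK u) -[in LHS](submxrowK v) tr_mxrow.
by rewrite mul_mxrow_mxcol summxE.
Qed.

Lemma continuous_dotvl (R : realType) (m : nat) (c : 'rV[R]_m) :
  continuous (fun v : 'rV[R]_m => dotv v c).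
Proof.
rewrite (_ : (fun v => _) = (fun v : 'rV[R]_m => \sum_j v 0 j * c 0 j)); last first.
  by apply/funext => v; rewrite /dotv mxE; apply: eq_bigr => j _; rewrite mxE.
apply: continuous_big => [|j _ v]; first exact: add_continuous.
apply: cvgMr_tmp; first exact: (nbhs_filter v).
exact: (@coord_continuous R 1 m 0 j v).
Qed.

Lemma argmin_linear_exists (R : realType) (m : nat) (X : set 'rV[R]_m)
    (c : 'rV[R]_m) :
  X !=set0 -> compact X -> exists s, is_argmin_linear X c s.
Proof.
move=> X0 cX.
have /(EVT_min_rV X0 cX)[s /set_mem Xs smin] :
    {within X, continuous (fun v : 'rV[R]_m => dotv v c)}.
  exact/continuous_subspaceT/continuous_dotvl.
by exists s; split => // v Xv; exact/smin/mem_set.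
Qed.

(** By linearity [dotv (x - v) c] is largest where [dotv v c] is smallest. Any minimizer gives the
    same value, so ties in the oracle do not affect the gap. *)
Lemma sup_linear_argmin (R : realType) (m : nat) (X : set 'rV[R]_m)
    (x c s : 'rV[R]_m) :
  is_argmin_linear X c s ->
  sup [set dotv (x - v) c | v in X] = dotv (x - s) c.
Proof.
move=> [Xs smin].
have ub : ubound [set dotv (x - v) c | v in X] (dotv (x - s) c).
  by move=> _ [v Xv <-]; rewrite !dotvBl lerD2l lerN2 smin.
apply/eqP; rewrite eq_le ge_sup ?ub_le_sup//=.
- by exists (dotv (x - s) c).
- by exists s.
- by exists (dotv (x - s) c); exists s.
Qed.

(** Both the linear form and the product constraint separate over blocks, so each block can be
    minimized on its own. *)
Lemma argmin_linear_block (R : realType) (Nb : nat) (dim : 'I_Nb -> nat)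
    (X : forall n : 'I_Nb, set 'rV[R]_(dim n))
    (c : 'rV[R]_(\sum_(n < Nb) dim n)) (s : forall n, 'rV[R]_(dim n)) :
  (forall n, is_argmin_linear (X n) (submxrow c n) (s n)) ->
  is_argmin_linear (block_product X) c (\mxrow_n s n).
Proof.
move=> smin; split=> [n|v Xv]; first by rewrite mxrowK; exact: (smin n).1.
rewrite !dotv_submxrow ler_sum// => n _; rewrite mxrowK.
exact/(smin n).2/Xv.
Qed.

(** The [g_n] of the overview. Written as a supremum, it depends on [x] alone and not on the
    oracle's answer, which may vary with the current draw. *)
Definition block_gap (R : realType) (Nb : nat) (dim : 'I_Nb -> nat)
    (X : forall n : 'I_Nb, set 'rV[R]_(dim n))
    (f : 'rV[R]_(\sum_(n < Nb) dim n) -> R)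
    (x : 'rV[R]_(\sum_(n < Nb) dim n)) (n : 'I_Nb) : R :=
  sup [set dotv (submxrow x n - u) (block_gradient f x n) | u in X n].

Lemma duality_gap_block (R : realType) (Nb : nat) (dim : 'I_Nb -> nat)
    (X : forall n : 'I_Nb, set 'rV[R]_(dim n))
    (f : 'rV[R]_(\sum_(n < Nb) dim n) -> R)
    (x : 'rV[R]_(\sum_(n < Nb) dim n)) :
  (forall n, X n !=set0) -> (forall n, compact (X n)) ->
  duality_gap (block_product X) f x = \sum_n block_gap X f x n.
Proof.
move=> X0 cX.
have /all_sig[s smin] n : {s | is_argmin_linear (X n) (block_gradient f x n) s}.
  exact/cid/argmin_linear_exists.
rewrite /duality_gap (sup_linear_argmin _ (argmin_linear_block smin)).
rewrite dotv_submxrow; apply: eq_bigr => n _.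
by rewrite submxrowB mxrowK /block_gap (sup_linear_argmin _ (smin n)).
Qed.

(** * Block steps *)

Lemma submxrow_block_step (R : realType) (Nb : nat) (dim : 'I_Nb -> nat)
    (gamma : R) (S : {set 'I_Nb}) (x : 'rV[R]_(\sum_(n < Nb) dim n))
    (s : forall n : 'I_Nb, 'rV[R]_(dim n)) (n : 'I_Nb) :
  submxrow (block_step gamma S x s) n =
    if n \in S then (1 - gamma) *: submxrow x n + gamma *: s n
    else submxrow x n.
Proof. by rewrite /block_step mxrowK. Qed.

Lemma block_step_feasible (R : realType) (Nb : nat) (dim : 'I_Nb -> nat)
    (X : forall n : 'I_Nb, set 'rV[R]_(dim n)) (gamma : R) (S : {set 'I_Nb})
    (x : 'rV[R]_(\sum_(n < Nb) dim n))
    (s : forall n : 'I_Nb, 'rV[R]_(dim n)) :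
  (forall n, convex_set (X n)) -> 0 <= gamma <= 1 -> block_product X x ->
  (forall n, n \in S -> X n (s n)) ->
  block_product X (block_step gamma S x s).
Proof.
move=> cvxX /andP[g0 g1] Xx Xs n; rewrite submxrow_block_step.
case: ifPn => [nS|_]; last exact: Xx.
have h0 : 0 <= 1 - gamma by rewrite subr_ge0.
have h1 : 1 - gamma <= 1 by rewrite lerBlDr lerDl.
(* The interval parameter weighs the first point, hence [1 - gamma]; its complement is [gamma] by
   [subKr]. *)
have := cvxX n (submxrow x n) (s n) (Itv01 h0 h1)
  (mem_set (Xx n)) (mem_set (Xs n nS)).
by move=> /set_mem; rewrite /conv/= /unstable.onem subKr.
Qed.

(** Tie-breaking constrains oracle answers only on the drawn blocks; comparing two runs therefore
    needs agreement on [S] only. *)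
Lemma eq_block_step (R : realType) (Nb : nat) (dim : 'I_Nb -> nat)
    (gamma : R) (S : {set 'I_Nb}) (x : 'rV[R]_(\sum_(n < Nb) dim n))
    (s s' : forall n : 'I_Nb, 'rV[R]_(dim n)) :
  (forall n, n \in S -> s n = s' n) ->
  block_step gamma S x s = block_step gamma S x s'.
Proof.
move=> ss'; apply: eq_mxrow => n.
by case: ifPn => // nS; rewrite ss'.
Qed.

Lemma block_step0 (R : realType) (Nb : nat) (dim : 'I_Nb -> nat)
    (S : {set 'I_Nb}) (x : 'rV[R]_(\sum_(n < Nb) dim n))
    (s : forall n : 'I_Nb, 'rV[R]_(dim n)) :
  block_step 0 S x s = x.
Proof.
rewrite -[RHS](submxrowK x); apply: eq_mxrow => n.
by rewrite subr0 scale1r scale0r addr0 if_same.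
Qed.

(** * Curvature and the descent of one step *)

(** If the oracle answers [x] itself, the step stays at [x] and the curvature quotient is zero. *)
Lemma set_curvature_ge0 (R : realType) (Nb : nat) (dim : 'I_Nb -> nat)
    (X : forall n : 'I_Nb, set 'rV[R]_(dim n))
    (f : 'rV[R]_(\sum_(n < Nb) dim n) -> R) (S : {set 'I_Nb})
    (x : 'rV[R]_(\sum_(n < Nb) dim n)) :
  block_product X x -> (0 <= set_curvature X f S)%E.
Proof.
move=> Xx; apply: ereal_sup_ubound; exists 1, x, (submxrow x).
have stepx : block_step 1 S x (submxrow x) = x.
  rewrite -[RHS](submxrowK x); apply: eq_mxrow => n.
  by rewrite subrr scale0r add0r scale1r if_same.
split => //=; first by rewrite ltr01 lexx.
rewrite stepx subrr big1 ?subrr ?mulr0// => n _.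
by rewrite subrr /dotv mul0mx mxE.
Qed.

(* A step on S is a full step whose oracle answers x itself off S. *)
Lemma set_curvature_le_full (R : realType) (Nb : nat) (dim : 'I_Nb -> nat)
    (X : forall n : 'I_Nb, set 'rV[R]_(dim n))
    (f : 'rV[R]_(\sum_(n < Nb) dim n) -> R) (S : {set 'I_Nb}) :
  (set_curvature X f S <= set_curvature X f [set: 'I_Nb]%SET)%E.
Proof.
apply: ereal_sup_le => _ [gamma [x [s [gamma01 Xx Xs ->]]]].
pose s' n := if n \in S then s n else submxrow x n.
have step_s' : block_step gamma [set: 'I_Nb]%SET x s' = block_step gamma S x s.
  apply: eq_mxrow => n; rewrite inE /s'; case: ifPn => // _.
  by rewrite -scalerDl subrK scale1r.
exists gamma, x, s'; split => //.
  by move=> n _; rewrite /s'; case: ifPn => [/Xs//|_]; exact: Xx.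
rewrite /= step_s'; congr ((_ * (_ - _))%:E).
rewrite [RHS](bigID (fun n => n \in S))/= [X in _ = _ + X]big1 ?addr0.
  by apply: eq_bigl => n; rewrite inE.
move=> n /andP[_ /negbTE nS]; rewrite submxrow_block_step nS subrr.
by rewrite /dotv mul0mx mxE.
Qed.

Lemma set_curvature_fin_num (R : realType) (Nb : nat) (dim : 'I_Nb -> nat)
    (X : forall n : 'I_Nb, set 'rV[R]_(dim n))
    (f : 'rV[R]_(\sum_(n < Nb) dim n) -> R) (S : {set 'I_Nb})
    (x : 'rV[R]_(\sum_(n < Nb) dim n)) :
  block_product X x -> set_curvature X f [set: 'I_Nb]%SET \is a fin_num ->
  set_curvature X f S \is a fin_num.
Proof.
move=> Xx Cfin; rewrite ge0_fin_numE ?(set_curvature_ge0 _ _ Xx)//.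
by rewrite (le_lt_trans (set_curvature_le_full _ _ _))// ltey_eq Cfin.
Qed.

(** The step is one of the competitors in the curvature supremum, and since [s n] is a minimizer its
    linear term on block [n] is exactly [- gamma] times the block gap. *)
Lemma block_step_descent (R : realType) (Nb : nat) (dim : 'I_Nb -> nat)
    (X : forall n : 'I_Nb, set 'rV[R]_(dim n))
    (f : 'rV[R]_(\sum_(n < Nb) dim n) -> R) (gamma : R) (S : {set 'I_Nb})
    (x : 'rV[R]_(\sum_(n < Nb) dim n))
    (s : forall n : 'I_Nb, 'rV[R]_(dim n)) :
  set_curvature X f S \is a fin_num -> 0 <= gamma <= 1 ->
  block_product X x ->
  (forall n, n \in S -> is_argmin_linear (X n) (block_gradient f x n) (s n)) ->
  f (block_step gamma S x s) <=
    f x - gamma * (\sum_(n in S) block_gap X f x n)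
    + gamma ^+ 2 / 2 * fine (set_curvature X f S).
Proof.
move=> Cfin /andP[g0 g1] Xx smin.
(* The curvature ranges over [gamma > 0]; a null step leaves [x] in place and is treated apart. *)
have [->|gN0] := eqVneq gamma 0.
  by rewrite block_step0 expr0n/= !mul0r subr0 addr0.
have {gN0}g0 : 0 < gamma by rewrite lt_def gN0.
have : ((2 / gamma ^+ 2 * (f (block_step gamma S x s) - f x
    - \sum_(n in S) dotv (submxrow (block_step gamma S x s) n - submxrow x n)
        (block_gradient f x n)))%:E <= set_curvature X f S)%E.
  apply: ereal_sup_ubound; exists gamma, x, s; split => //.
    by rewrite g0.
  by move=> n /smin[].
rewrite -(fineK Cfin) lee_fin.
rewrite [X in _ - X](_ : _ = - (gamma * \sum_(n in S) block_gap X f x n)).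
  move=> H; rewrite -ler_pdivlMl ?divr_gt0 ?exprn_gt0// in H.
  by rewrite invf_div in H; lra.
rewrite mulr_sumr -sumrN; apply: eq_bigr => n nS.
rewrite submxrow_block_step nS /block_gap (sup_linear_argmin _ (smin n nS)).
rewrite (_ : _ - _ = - gamma *: (submxrow x n - s n)); last first.
  by rewrite scalerBl scale1r addrAC [_ - _ - _]addrAC subrr sub0r scalerBr
    !scaleNr opprK.
by rewrite dotvZl mulNr.
Qed.

(** * Random variables with finite range *)

(** [F] is constant on each fibre of [g], so choice yields [phi]; [c0] fills in the points outside
    the range of [g]. *)
Lemma factor_through (A B C : Type) (c0 : C) (g : A -> B) (F : A -> C) :
  (forall a a', g a = g a' -> F a = F a') ->
  exists phi : B -> C, forall a, F a = phi (g a).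
Proof.
move=> gF.
have /choice[phi phiE] (b : B) : exists c, forall a, g a = b -> F a = c.
  have [[a <-]|nb] := pselect (exists a, g a = b).
    by exists (F a) => a' /gF.
  by exists c0 => a gab; case: nb; exists a.
by exists phi => a; exact: phiE.
Qed.

Definition point_mass (R : realType) (disp : measure_display)
    (Omega : measurableType disp) (P : probability Omega R) (T : Type)
    (Z : Omega -> T) (z : T) : R := fine (P (Z @^-1` [set z])).

(** [phi (Z w)] is a finite combination of indicators of the fibres of [Z]. With [phi] arbitrary,
    this applies to [f] and to the duality gap along the iterates. *)
Lemma expectation_finite_range (R : realType) (disp : measure_display)
    (Omega : measurableType disp) (P : probability Omega R) (T : finType)
    (Z : Omega -> T) (phi : T -> R) :
  (forall z, measurable (Z @^-1` [set z])) ->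
  ('E_P[fun w => phi (Z w)] = (\sum_z phi z * point_mass P Z z)%:E)%E.
Proof.
move=> mZ; rewrite unlock.
have -> : (fun w => (phi (Z w))%:E) =
    (fun w => \sum_z (phi z)%:E * (\1_(Z @^-1` [set z]) w)%:E)%E.
  apply/funext => w; rewrite (bigD1 (Z w))//= big1 ?adde0.
    by rewrite indicE mem_set//= mule1.
  move=> z zN; rewrite indicE memNset ?mule0//= => Zz.
  by rewrite Zz eqxx in zN.
rewrite integral_sum//; last first.
  by move=> z; apply: integrableZl => //; exact: integrable_indic.
rewrite -sumEFin; apply: eq_bigr => z _.
rewrite integralZl//; last exact: integrable_indic.
by rewrite integral_indic// setIT EFinM fineK// fin_num_measure.
Qed.

Lemma sum_point_mass (R : realType) (disp : measure_display)
    (Omega : measurableType disp) (P : probability Omega R) (T : finType)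
    (Z : Omega -> T) :
  (forall z, measurable (Z @^-1` [set z])) -> \sum_z point_mass P Z z = 1.
Proof.
move=> mZ; have := expectation_finite_range P (fun=> 1) mZ.
rewrite (expectation_cst P 1) => -[->].
by apply: eq_bigr => z _; rewrite mul1r.
Qed.

(** Values that [Z] never takes have mass zero, so comparing on the range suffices. This matters for
    functions from [factor_through], which are arbitrary off the range. *)
Lemma ler_sum_point_mass (R : realType) (disp : measure_display)
    (Omega : measurableType disp) (P : probability Omega R) (T : finType)
    (Z : Omega -> T) (phi psi : T -> R) :
  (forall w, phi (Z w) <= psi (Z w)) ->
  \sum_z phi z * point_mass P Z z <= \sum_z psi z * point_mass P Z z.
Proof.
move=> le_phi; apply: ler_sum => z _.
have [[w <-]|Zz] := pselect (exists w, Z w = z).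
  by rewrite ler_wpM2r// fine_ge0// measure_ge0.
rewrite /point_mass (_ : Z @^-1` _ = set0) ?measure0 ?mulr0//.
by apply/seteqP; split => // w /= Zw; case: Zz; exists w.
Qed.

(** * Probability that a block is drawn *)

(* Pascal's rule: the draws avoiding [x] are the draws from [[set~ x]]. *)
Lemma card_draws_mem (T : finType) (B : nat) (x : T) :
  (0 < B)%N -> #|[set S : {set T} | (#|S| == B) && (x \in S)]%SET| = 'C(#|T|.-1, B.-1).
Proof.
case: B => // B _ /=.
have T0 : (0 < #|T|)%N by apply/card_gt0P; exists x.
have := card_draws T B.+1; rewrite -[X in 'C(X, _)](prednK T0) binS.
rewrite -(cardsID [set S : {set T} | x \in S]%SET).
rewrite [X in (_ + X)%N](_ : _ = 'C(#|T|.-1, B.+1)) 1?addnC.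
  move=> /addnI <-; congr #|pred_of_set _|; apply/setP => S.
  by rewrite !inE.
rewrite -(cardsC1 x) -cards_draws; congr #|pred_of_set _|; apply/setP => S.
by rewrite !inE -finset.disjoints_subset fintype.disjoint_sym disjoints1.
Qed.

(** After exchanging the sums, block [n] is counted once per draw containing it, ['C(Nb.-1, B.-1)]
    times, and [Nb * 'C(Nb.-1, B.-1) = B * 'C(Nb, B)]. *)
Lemma sum_draws_mem (R : realType) (Nb B : nat) (b : 'I_Nb -> R) :
  (1 <= B <= Nb)%N ->
  \sum_(S : {set 'I_Nb} | #|S| == B) 'C(Nb, B)%:R^-1 * (\sum_(n in S) b n) =
  B%:R / Nb%:R * \sum_n b n.
Proof.
move=> /andP[B0 BNb].
have Nb0 : (0 < Nb)%N by exact: leq_trans BNb.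
rewrite -mulr_sumr (exchange_big_dep xpredT)//= !mulr_sumr.
apply: eq_bigr => n _; rewrite sumr_const.
have -> : #|[pred S : {set 'I_Nb} | (#|S| == B) && (n \in S)]| = 'C(Nb.-1, B.-1).
  rewrite -[in RHS](card_ord Nb) -(card_draws_mem n B0).
  by apply: eq_card => S; rewrite !inE.
have /(congr1 (fun k => k%:R : R)) := mul_bin_diag Nb B.-1.
rewrite !prednK// !natrM => binE.
have CN0 : 'C(Nb, B)%:R != 0 :> R by rewrite pnatr_eq0 -lt0n bin_gt0.
have NbN0 : Nb%:R != 0 :> R by rewrite pnatr_eq0 -lt0n.
rewrite -[b n *+ _]mulr_natl mulrA; congr (_ * _).
apply: (mulfI CN0); apply: (mulfI NbN0); rewrite mulVKf// binE; by field.
Qed.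

(** * The past draws and their independence from the current one *)

(** Draw [k] itself is excluded: these are the draws that determine [x k]. Over a finite [T] the
    tuples form a finite type, so expectations become finite sums. *)
Definition history (Omega T : Type) (draw : nat -> Omega -> T) (k : nat)
    (w : Omega) : k.-tuple T := [tuple draw i w | i < k].

(** Puts the event in the form expected by [draw_independent]; [a] is only a default for [nth]. *)
Lemma history_preimage (Omega T : Type) (draw : nat -> Omega -> T) (k : nat)
    (h : k.-tuple T) (a : T) :
  history draw k @^-1` [set h] =
  \bigcap_(i in [set` iota 0 k]) draw i @^-1` [set nth a h i].
Proof.
apply/seteqP; split => [w /= <- i|w hw].
  rewrite /mkset mem_iota => /= ik.
  by rewrite (nth_mktuple _ _ (Ordinal ik)).
apply/eq_from_tnth => i; rewrite tnth_mktuple (tnth_nth a).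
by apply: hw; rewrite /mkset mem_iota add0n /=.
Qed.

(* [h] has size [k], so [nth a h k] is the default value [a]. *)
Lemma history_draw_preimage (Omega T : Type) (draw : nat -> Omega -> T)
    (k : nat) (h : k.-tuple T) (a : T) :
  (fun w => (history draw k w, draw k w)) @^-1` [set (h, a)] =
  \bigcap_(i in [set` iota 0 k.+1]) draw i @^-1` [set nth a h i].
Proof.
apply/seteqP; split => [w [hE aE] i|w hw].
  rewrite /preimage /mkset mem_iota add0n => /andP[_].
  rewrite ltnS leq_eqVlt => /orP[/eqP->|ik].
    by rewrite nth_default ?size_tuple.
  by rewrite -hE (nth_mktuple _ _ (Ordinal ik)).
have drawE i : (i <= k)%N -> draw i w = nth a h i.
  by move=> ik; apply: hw; rewrite /mkset mem_iota add0n ltnS.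
congr pair; last by rewrite drawE// nth_default ?size_tuple.
by apply/eq_from_tnth => i; rewrite tnth_mktuple (tnth_nth a) drawE// ltnW.
Qed.

Lemma history_measurable (R : realType) (disp : measure_display)
    (Omega : measurableType disp) (P : probability Omega R) (Nb B : nat)
    (draw : nat -> Omega -> {set 'I_Nb}) (k : nat) (h : k.-tuple {set 'I_Nb}) :
  iid_uniform_draws P B draw -> measurable (history draw k @^-1` [set h]).
Proof.
move=> iid; rewrite (history_preimage _ _ finset.set0).
by apply: fin_bigcap_measurable => // i _; exact: draw_measurable iid _ _.
Qed.

Lemma history_draw_measurable (R : realType) (disp : measure_display)
    (Omega : measurableType disp) (P : probability Omega R) (Nb B : nat)
    (draw : nat -> Omega -> {set 'I_Nb}) (k : nat)
    (z : k.-tuple {set 'I_Nb} * {set 'I_Nb}) :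
  iid_uniform_draws P B draw ->
  measurable ((fun w => (history draw k w, draw k w)) @^-1` [set z]).
Proof.
case: z => h S iid; rewrite history_draw_preimage.
by apply: fin_bigcap_measurable => // i _; exact: draw_measurable iid _ _.
Qed.

Lemma point_mass_draw (R : realType) (disp : measure_display)
    (Omega : measurableType disp) (P : probability Omega R) (Nb B : nat)
    (draw : nat -> Omega -> {set 'I_Nb}) (k : nat) (S : {set 'I_Nb}) :
  iid_uniform_draws P B draw ->
  point_mass P (draw k) S = if #|S| == B then 'C(Nb, B)%:R^-1 else 0.
Proof. by move=> iid; rewrite /point_mass (draw_uniform iid). Qed.

(** Both events are intersections over initial segments of draws, so by mutual independence their
    probabilities are products that differ by the factor of draw [k]. *)
Lemma point_mass_history_draw (R : realType) (disp : measure_display)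
    (Omega : measurableType disp) (P : probability Omega R) (Nb B : nat)
    (draw : nat -> Omega -> {set 'I_Nb}) (k : nat)
    (h : k.-tuple {set 'I_Nb}) (S : {set 'I_Nb}) :
  iid_uniform_draws P B draw ->
  point_mass P (fun w => (history draw k w, draw k w)) (h, S) =
  point_mass P (history draw k) h * point_mass P (draw k) S.
Proof.
move=> iid; have indep := draw_independent iid.
(* Taking the default [S] in both preimages lets one family of events [nth S h i] serve for both; at
   index [k] it returns [S]. *)
rewrite /point_mass history_draw_preimage (history_preimage _ _ S).
rewrite (indep _ (fun i => [set nth S h i]) (iota_uniq _ _)).
rewrite (indep _ (fun i => [set nth S h i]) (iota_uniq _ _)).
rewrite -addn1 iotaD big_cat/= big_seq1 add0n nth_default ?size_tuple//.
(* The product over the past is finite because it is again the probability of an intersection. *)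
rewrite fineM// ?fin_num_measure//; last 2 first.
- rewrite -(indep _ (fun i => [set nth S h i]) (iota_uniq _ _)).
  rewrite fin_num_measure//; apply: fin_bigcap_measurable => // i _.
  exact: draw_measurable iid _ _.
- exact: draw_measurable iid _ _.
Qed.

(** * Iterates as functions of the past draws *)

Lemma iterate_feasible (R : realType) (Nb : nat) (dim : 'I_Nb -> nat)
    (X : forall n : 'I_Nb, set 'rV[R]_(dim n))
    (f : 'rV[R]_(\sum_(n < Nb) dim n) -> R) (gamma : nat -> R)
    (Omega : Type) (draw : nat -> Omega -> {set 'I_Nb})
    (x0 : 'rV[R]_(\sum_(n < Nb) dim n))
    (s : nat -> Omega -> forall n : 'I_Nb, 'rV[R]_(dim n))
    (x : nat -> Omega -> 'rV[R]_(\sum_(n < Nb) dim n)) :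
  (forall n, convex_set (X n)) -> (forall t, 0 <= gamma t <= 1) ->
  block_frank_wolfe X f gamma draw x0 s x ->
  forall k w, block_product X (x k w).
Proof.
move=> cvxX gamma01 run; elim=> [|k IHk] w.
  by rewrite (fw_init run); exact: fw_init_feasible run.
rewrite (fw_step run); apply: block_step_feasible => // n nS.
exact: (fw_oracle run nS).1.
Qed.

(** Passing from [x k] to [x k.+1] uses draw [k] and an oracle answer fixed by draws [0] to [k], so
    the bound on the indices stays strict. *)
Lemma iterate_eq (R : realType) (Nb : nat) (dim : 'I_Nb -> nat)
    (X : forall n : 'I_Nb, set 'rV[R]_(dim n))
    (f : 'rV[R]_(\sum_(n < Nb) dim n) -> R) (gamma : nat -> R)
    (Omega : Type) (draw : nat -> Omega -> {set 'I_Nb})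
    (x0 : 'rV[R]_(\sum_(n < Nb) dim n))
    (s : nat -> Omega -> forall n : 'I_Nb, 'rV[R]_(dim n))
    (x : nat -> Omega -> 'rV[R]_(\sum_(n < Nb) dim n)) (k : nat) (w w' : Omega) :
  block_frank_wolfe X f gamma draw x0 s x ->
  (forall i, (i < k)%N -> draw i w = draw i w') -> x k w = x k w'.
Proof.
move=> run; elim: k => [|k IHk] dww'; first by rewrite !(fw_init run).
rewrite !(fw_step run) IHk => [|i ik]; last exact/dww'/ltnW.
rewrite -(dww' k)//; apply: eq_block_step => n nS.
exact: (fw_tie_breaking run dww').
Qed.

Lemma history_eq (Omega T : Type) (draw : nat -> Omega -> T) (k : nat)
    (w w' : Omega) :
  history draw k w = history draw k w' ->
  forall i, (i < k)%N -> draw i w = draw i w'.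
Proof.
move=> hE i ik; have := congr1 (fun h => tnth h (Ordinal ik)) hE.
by rewrite !tnth_mktuple.
Qed.

Lemma iterate_history (R : realType) (Nb : nat) (dim : 'I_Nb -> nat)
    (X : forall n : 'I_Nb, set 'rV[R]_(dim n))
    (f : 'rV[R]_(\sum_(n < Nb) dim n) -> R) (gamma : nat -> R)
    (Omega : Type) (draw : nat -> Omega -> {set 'I_Nb})
    (x0 : 'rV[R]_(\sum_(n < Nb) dim n))
    (s : nat -> Omega -> forall n : 'I_Nb, 'rV[R]_(dim n))
    (x : nat -> Omega -> 'rV[R]_(\sum_(n < Nb) dim n)) (k : nat) :
  block_frank_wolfe X f gamma draw x0 s x ->
  exists xi : k.-tuple {set 'I_Nb} -> 'rV[R]_(\sum_(n < Nb) dim n),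
    forall w, x k w = xi (history draw k w).
Proof.
move=> run; apply: (factor_through x0) => w w' hw.
exact: iterate_eq run (history_eq hw).
Qed.

(** * Expectations along the run *)

(** Finiteness allows passing between extended-real expectations and their [fine] parts. *)
Lemma expectation_iterate_fin_num (R : realType) (Nb B : nat)
    (dim : 'I_Nb -> nat) (X : forall n : 'I_Nb, set 'rV[R]_(dim n))
    (f : 'rV[R]_(\sum_(n < Nb) dim n) -> R) (gamma : nat -> R)
    (disp : measure_display) (Omega : measurableType disp)
    (P : probability Omega R)
    (draw : nat -> Omega -> {set 'I_Nb})
    (x0 : 'rV[R]_(\sum_(n < Nb) dim n))
    (s : nat -> Omega -> forall n : 'I_Nb, 'rV[R]_(dim n))
    (x : nat -> Omega -> 'rV[R]_(\sum_(n < Nb) dim n))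
    (F : 'rV[R]_(\sum_(n < Nb) dim n) -> R) (k : nat) :
  iid_uniform_draws P B draw -> block_frank_wolfe X f gamma draw x0 s x ->
  ('E_P[fun w => F (x k w)] \is a fin_num)%E.
Proof.
move=> iid run; have [xi xiE] := iterate_history k run.
under [X in ('E_P[X])%E]eq_fun do rewrite xiE.
rewrite (expectation_finite_range P (fun h => F (xi h)))// => h.
exact: history_measurable iid.
Qed.

Lemma expectation_iterate_ge (R : realType) (Nb B : nat)
    (dim : 'I_Nb -> nat) (X : forall n : 'I_Nb, set 'rV[R]_(dim n))
    (f : 'rV[R]_(\sum_(n < Nb) dim n) -> R) (gamma : nat -> R)
    (disp : measure_display) (Omega : measurableType disp)
    (P : probability Omega R)
    (draw : nat -> Omega -> {set 'I_Nb})
    (x0 : 'rV[R]_(\sum_(n < Nb) dim n))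
    (s : nat -> Omega -> forall n : 'I_Nb, 'rV[R]_(dim n))
    (x : nat -> Omega -> 'rV[R]_(\sum_(n < Nb) dim n))
    (F : 'rV[R]_(\sum_(n < Nb) dim n) -> R) (a : R) (k : nat) :
  iid_uniform_draws P B draw -> block_frank_wolfe X f gamma draw x0 s x ->
  (forall w, a <= F (x k w)) -> a <= fine 'E_P[fun w => F (x k w)].
Proof.
move=> iid run aF; have [xi xiE] := iterate_history k run.
have mhist h : measurable (history draw k @^-1` [set h]).
  exact: history_measurable iid.
under [X in ('E_P[X])%E]eq_fun do rewrite xiE.
rewrite (expectation_finite_range P (fun h => F (xi h)))//=.
rewrite -[leLHS]mulr1 -(sum_point_mass P mhist) mulr_sumr.
by apply: (ler_sum_point_mass P (phi := fun=> a)) => w; rewrite -xiE.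
Qed.

(** All expectations are sums over the joint law of past and current draw. This law factors, so the
    pathwise descent is averaged over the current draw first, with the past held fixed. *)
Lemma expectation_descent (R : realType) (Nb B : nat) (dim : 'I_Nb -> nat)
    (X : forall n : 'I_Nb, set 'rV[R]_(dim n))
    (f : 'rV[R]_(\sum_(n < Nb) dim n) -> R) (gamma : nat -> R)
    (disp : measure_display) (Omega : measurableType disp)
    (P : probability Omega R)
    (draw : nat -> Omega -> {set 'I_Nb})
    (x0 : 'rV[R]_(\sum_(n < Nb) dim n))
    (s : nat -> Omega -> forall n : 'I_Nb, 'rV[R]_(dim n))
    (x : nat -> Omega -> 'rV[R]_(\sum_(n < Nb) dim n)) (k : nat) :
  (1 <= B <= Nb)%N ->
  (forall n, X n !=set0) -> (forall n, convex_set (X n)) ->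
  (forall n, compact (X n)) ->
  set_curvature X f [set: 'I_Nb]%SET \is a fin_num ->
  (forall t, 0 <= gamma t <= 1) ->
  iid_uniform_draws P B draw -> block_frank_wolfe X f gamma draw x0 s x ->
  fine 'E_P[fun w => f (x k.+1 w)] <=
    fine 'E_P[fun w => f (x k w)]
    - gamma k * (B%:R / Nb%:R)
      * fine 'E_P[fun w => duality_gap (block_product X) f (x k w)]
    + gamma k ^+ 2 / 2 * fine (expected_set_curvature X f B).
Proof.
move=> BNb X0 cvxX cX Cfin gamma01 iid run.
have Xx := iterate_feasible cvxX gamma01 run.
pose Z w := (history draw k w, draw k w).
pose c S := fine (set_curvature X f S).
have CSfin S : set_curvature X f S \is a fin_num.
  exact: set_curvature_fin_num (fw_init_feasible run) Cfin.
have [xi xiE] := iterate_history k run.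
(* The next iterate also sees draw [k], hence a function of the pair [Z] rather than of the
   history. *)
have [xi' xi'E] : exists xi', forall w, x k.+1 w = xi' (Z w).
  apply: (factor_through x0) => w w' ZE.
  have hw := history_eq (congr1 fst ZE).
  have dE : draw k w = draw k w' := congr1 snd ZE.
  apply: (iterate_eq run) => i; rewrite ltnS leq_eqVlt.
  by move=> /orP[/eqP->//|]; exact: hw.
have mhist h : measurable (history draw k @^-1` [set h]).
  exact: history_measurable iid.
have mdraw S : measurable (draw k @^-1` [set S]) by exact: draw_measurable iid _ _.
have mZ z : measurable (Z @^-1` [set z]) by exact: history_draw_measurable iid.
have curvE : expected_set_curvature X f B = (\sum_S point_mass P (draw k) S * c S)%:E.
  rewrite /expected_set_curvature.
  under eq_bigr do rewrite -(fineK (CSfin _)).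
  rewrite sumEFin -EFinM mulr_sumr big_mkcond; congr EFin.
  by apply: eq_bigr => S _; rewrite (point_mass_draw k S iid); case: ifP => //;
    rewrite mul0r.
rewrite (_ : (fun w => f (x k.+1 w)) = (fun w => f (xi' (Z w)))); last first.
  by apply/funext => w; rewrite xi'E.
rewrite (_ : (fun w => f (x k w)) = (fun w => f (xi (history draw k w)))); last first.
  by apply/funext => w; rewrite xiE.
rewrite (_ : (fun w => duality_gap _ f (x k w)) =
    (fun w => duality_gap (block_product X) f (xi (history draw k w)))); last first.
  by apply/funext => w; rewrite xiE.
rewrite (expectation_finite_range P (fun z => f (xi' z)) mZ).
rewrite (expectation_finite_range P (fun h => f (xi h)) mhist).
rewrite (expectation_finite_range P
  (fun h => duality_gap (block_product X) f (xi h)) mhist) curvE /=.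
(* The right-hand side of the one-step descent, as a function of past draws [z.1] and current draw
   [z.2]. *)
pose phi (z : k.-tuple {set 'I_Nb} * {set 'I_Nb}) :=
  f (xi z.1) - gamma k * (\sum_(n in z.2) block_gap X f (xi z.1) n)
  + gamma k ^+ 2 / 2 * c z.2.
have le_phi w : f (xi' (Z w)) <= phi (Z w).
  rewrite -xi'E /phi /= -xiE (fw_step run); apply: block_step_descent => // n nS.
  exact: (fw_oracle run nS).
apply: le_trans (@ler_sum_point_mass _ _ _ P _ Z (f \o xi') phi le_phi) _.
pose q := point_mass P (history draw k); pose p := point_mass P (draw k).
have sum_q : \sum_h q h = 1 by exact: sum_point_mass.
have sum_p : \sum_S p S = 1 by exact: sum_point_mass.
have sum_p_mem b : \sum_S p S * (\sum_(n in S) b n) = B%:R / Nb%:R * \sum_n b n.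
  rewrite -(sum_draws_mem b BNb) [RHS]big_mkcond; apply: eq_bigr => S _.
  by rewrite /p (point_mass_draw k S iid); case: ifP => //; rewrite mul0r.
(* Conditional expectation of [phi] given the past [h], weighted by [q h]; here [alpha] and the
   expected curvature appear. *)
have sum_h h : \sum_S phi (h, S) * (q h * p S) =
    f (xi h) * q h - gamma k * (B%:R / Nb%:R)
      * (duality_gap (block_product X) f (xi h) * q h)
    + gamma k ^+ 2 / 2 * (\sum_S p S * c S) * q h.
  rewrite duality_gap_block// (eq_bigr (fun S => f (xi h) * q h * p S
    + (- (gamma k * q h) * (p S * \sum_(n in S) block_gap X f (xi h) n)
    + gamma k ^+ 2 / 2 * q h * (p S * c S)))) => [|S _]; last first.
    by rewrite /phi/=; ring.
  rewrite !big_split/= -!mulr_sumr sum_p sum_p_mem; ring.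
(* Independence enters here: the joint mass splits into [q] times [p]. *)
rewrite (eq_bigr (fun z => phi (z.1, z.2) * (q z.1 * p z.2))) => [|[h S] _]; last first.
  by rewrite (point_mass_history_draw h S iid).
rewrite -(pair_bigA _ (fun h S => phi (h, S) * (q h * p S)))/=.
under eq_bigr do rewrite sum_h.
by rewrite !big_split/= sumrN -!mulr_sumr sum_q mulr1.
Qed.

(** * Summation of the descent over the iterations *)

Theorem theorem3 (R : realType) (Nb B : nat) (dim : 'I_Nb -> nat)
    (X : forall n : 'I_Nb, set 'rV[R]_(dim n))
    (U : set 'rV[R]_(\sum_(n < Nb) dim n))
    (f : 'rV[R]_(\sum_(n < Nb) dim n) -> R)
    (xstar x0 : 'rV[R]_(\sum_(n < Nb) dim n))
    (gamma : nat -> R)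
    (disp : measure_display) (Omega : measurableType disp)
    (P : probability Omega R)
    (draw : nat -> Omega -> {set 'I_Nb})
    (s : nat -> Omega -> forall n : 'I_Nb, 'rV[R]_(dim n))
    (x : nat -> Omega -> 'rV[R]_(\sum_(n < Nb) dim n))
    (Nb_ge1 : (1 <= Nb)%N)
    (B_range : (1 <= B <= Nb)%N)
    (X_nonempty : forall n, X n !=set0)
    (X_convex : forall n, convex_set (X n))
    (X_compact : forall n, compact (X n))
    (U_open : open U)
    (X_sub_U : block_product X `<=` U)
    (f_diff : forall z, U z -> differentiable f z)
    (xstar_feasible : block_product X xstar)
    (xstar_min : forall z, block_product X z -> f xstar <= f z)
    (Cf_finite : set_curvature X f [set: 'I_Nb] \is a fin_num)
    (gamma_range : forall t, 0 <= gamma t <= 1)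
    (draws : iid_uniform_draws P B draw)
    (run : block_frank_wolfe X f gamma draw x0 s x)
    (t : nat)
    (sum_gamma_gt0 : 0 < \sum_(k < t.+1) gamma k) :
  let alpha : R := B%:R / Nb%:R in
  let h z : R := f z - f xstar in
  (\big[mine/+oo]_(k < t.+1)
      'E_P[fun w => duality_gap (block_product X) f (x k w)]
   <= (h x0 / (alpha * \sum_(k < t.+1) gamma k))%:E
      + expected_set_curvature X f B
        * ((\sum_(k < t.+1) gamma k ^+ 2)
           / (2 * alpha * \sum_(k < t.+1) gamma k))%:E)%E.
Proof.
cbv zeta; set alpha : R := B%:R / Nb%:R.
have [B0 BNb] := andP B_range.
have alpha0 : 0 < alpha by rewrite divr_gt0// ltr0n.
pose e k := fine 'E_P[fun w => f (x k w)].
pose d k := fine 'E_P[fun w => duality_gap (block_product X) f (x k w)].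
pose C := fine (expected_set_curvature X f B).
have descent k : e k.+1 <= e k - gamma k * alpha * d k + gamma k ^+ 2 / 2 * C.
  exact: expectation_descent draws run.
have telescope m : e m <= f x0 - alpha * (\sum_(k < m) gamma k * d k)
    + (\sum_(k < m) gamma k ^+ 2) / 2 * C.
  elim: m => [|m IHm].
    rewrite !big_ord0 mulr0 !mul0r subr0 addr0 /e.
    under [X in ('E_P[X])%E]eq_fun do rewrite (fw_init run).
    by rewrite (expectation_cst P (f x0)).
  rewrite !big_ord_recr/=; apply: (le_trans (descent m)).
  by move: IHm; lra.
(* Bounding the last value by the optimum turns [f x0] into [h x0] after telescoping. *)
have e_ge : f xstar <= e t.+1.
  apply: (expectation_iterate_ge draws run) => w.
  exact/xstar_min/(iterate_feasible X_convex gamma_range run).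
have Cfin : expected_set_curvature X f B = C%:E.
  rewrite fineK// /expected_set_curvature fin_numM// sum_fin_num.
  apply/allP => _ /mapP[S _ ->].
  exact: set_curvature_fin_num xstar_feasible Cf_finite.
rewrite Cfin -EFinM -EFinD.
set M := (\big[mine/+oo]_(k < t.+1) _)%E.
have le_M (k : 'I_t.+1) : (M <= (d k)%:E)%E.
  rewrite fineK; first exact: bigmin_le.
  exact: expectation_iterate_fin_num draws run.
(* The minimum lies below the finite [d 0], which excludes [+oo]; [-oo] is below any bound. *)
case: M le_M => [m|/(_ ord0)|_]; [|by []|exact: leNye].
move=> le_m; rewrite lee_fin.
have sum_ge : m * (\sum_(k < t.+1) gamma k) <= \sum_(k < t.+1) gamma k * d k.
  rewrite mulr_sumr; apply: ler_sum => k _; rewrite mulrC ler_wpM2l//.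
    by have /andP[] := gamma_range k.
  by rewrite -lee_fin.
have -> : (f x0 - f xstar) / (alpha * \sum_(k < t.+1) gamma k)
    + C * ((\sum_(k < t.+1) gamma k ^+ 2)
           / (2 * alpha * \sum_(k < t.+1) gamma k)) =
    ((f x0 - f xstar) + (\sum_(k < t.+1) gamma k ^+ 2) / 2 * C)
    / (alpha * \sum_(k < t.+1) gamma k).
  by field; rewrite !lt0r_neq0.
(* With denominators cleared, the claim is linear in the telescoped bound, [e_ge] and [alpha] times
   [sum_ge]. *)
rewrite ler_pdivlMr; last exact: mulr_gt0.
have := telescope t.+1; have := ler_wpM2l (ltW alpha0) sum_ge.
by lra.
Qed.
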